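(* Let $C\subset\mathbb{R}^n$ be a nonempty closed semi-algebraic set. Assume that $\nu$ is a semi-algebraic norm on $\mathbb{R}^n$ such that $\nu$ and its dual norm $\nu^*$ are differentiable. Then the set $S(C)$ of all points $\mathbf{x}\in\mathbb{R}^n$ at which the best $\nu$-approximation to $\mathbf{x}$ in $C$ is not unique is a nowhere dense semi-algebraic set. In particular, $S(C)$ is contained in some hypersurface $H\subset\mathbb{R}^n$.
   Context: A norm $\nu$ on $\mathbb{R}^n$ is semi-algebraic if its graph is a semi-algebraic subset of $\mathbb{R}^{n+1}$. The dual norm is $\nu^*(\mathbf{x})=\max\{\mathbf{y}^\top\mathbf{x}:\nu(\mathbf{y})=1\}$. A norm is called differentiable if it is differentiable at every $\mathbf{x}\neq\mathbf{0}$ (equivalently, it belongs to $C^1(\mathbb{R}^n\setminus\{\mathbf{0}\})$). For a nonempty closed $C\subset\mathbb{R}^n$ put $\mathrm{dist}_\nu(\mathbf{x},C)=\min\{\nu(\mathbf{x}-\mathbf{y}):\mathbf{y}\in C\}$; a point $\mathbf{y}^\star\in C$ is a best $\nu$-approximation of $\mathbf{x}$ in $C$ if $\nu(\mathbf{x}-\mathbf{y}^\star)=\mathrm{dist}_\nu(\mathbf{x},C)$. A hypersurface in $\mathbb{R}^n$ means the zero set of a nonconstant real polynomial in $n$ variables. *)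

(* Defs.v *)
From mathcomp Require Import all_boot all_order all_algebra.
From mathcomp Require Import all_classical all_reals all_analysis.
(* Not imported: its notations clash with those of all_analysis. *)
From mathcomp Require mpoly.

Set Implicit Arguments.
Unset Strict Implicit.
Unset Printing Implicit Defensive.

Import Order.TTheory GRing.Theory Num.Theory.
Import numFieldNormedType.Exports.

Local Open Scope classical_set_scope.
Local Open Scope ring_scope.

Section Definitions.
Context {R : realType}.

Definition peval n (p : mpoly.mpoly n R) (x : 'rV[R]_n) : R :=
  mpoly.meval (fun i => x ord0 i) p.

(* A pair (E, F) of finite lists of polynomials encodes the basic set
   { x | p(x) = 0 for all p in E, q(x) > 0 for all q in F }. *)
Definition basic_semialgebraic n
    (d : seq (mpoly.mpoly n R) * seq (mpoly.mpoly n R)) : set 'rV[R]_n :=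
  [set x | all (fun p => peval p x == 0) d.1 && all (fun q => 0 < peval q x) d.2].

Definition semialgebraic n (A : set 'rV[R]_n) : Prop :=
  exists s : seq (seq (mpoly.mpoly n R) * seq (mpoly.mpoly n R)),
    A = \big[setU/set0]_(d <- s) basic_semialgebraic d.

Definition hypersurface n (H : set 'rV[R]_n) : Prop :=
  exists p : mpoly.mpoly n R,
    (forall c : R, p <> mpoly.mpolyC n c) /\ H = [set x | peval p x = 0].

Definition nowhere_dense (T : topologicalType) (A : set T) : Prop :=
  interior (closure A) = set0.

Definition is_norm n (nu : 'rV[R]_n -> R) : Prop :=
  [/\ forall x, 0 <= nu x,
      forall x, nu x = 0 -> x = 0,
      forall (a : R) x, nu (a *: x) = `|a| * nu x
    & forall x y, nu (x + y) <= nu x + nu y].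

Definition graph n (f : 'rV[R]_n -> R) : set 'rV[R]_(n + 1) :=
  [set row_mx x (f x)%:M | x in [set: 'rV[R]_n]].

Definition dotr n (y x : 'rV[R]_n) : R := \sum_(i < n) y ord0 i * x ord0 i.

(* For a norm on R^n with n > 0 the supremum is a maximum, by compactness of
   the unit sphere. *)
Definition dual_norm n (nu : 'rV[R]_n -> R) (x : 'rV[R]_n) : R :=
  sup [set dotr y x | y in [set y | nu y = 1]].

Definition differentiable_norm n (nu : 'rV[R]_n -> R) : Prop :=
  forall x : 'rV[R]_n, x != 0 -> differentiable nu x.

(* For a norm and a nonempty closed C the infimum is a minimum. *)
Definition dist n (nu : 'rV[R]_n -> R) (x : 'rV[R]_n) (C : set 'rV[R]_n) : R :=
  inf [set nu (x - y) | y in C].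

Definition best_approx n (nu : 'rV[R]_n -> R) (C : set 'rV[R]_n)
    (x y : 'rV[R]_n) : Prop :=
  C y /\ nu (x - y) = dist nu x C.

Definition nonunique_set n (nu : 'rV[R]_n -> R) (C : set 'rV[R]_n) :
    set 'rV[R]_n :=
  [set x | exists y1 y2, [/\ best_approx nu C x y1, best_approx nu C x y2
                           & y1 <> y2]].

End Definitions.

(* Main.v *)
Require Import Defs.
From mathcomp Require Import all_boot all_order all_algebra.
From mathcomp Require Import all_classical all_reals all_analysis.
From mathcomp Require mpoly ordered_qelim qe_rcf.
Import (canonicals) mpoly.

(** Two independent facts give the theorem.

    The set S(C) is semi-algebraic because it is defined by a first-order
    formula over the real field: x lies in S(C) when there are y1 and y2 in C,
    distinct, such that no z in C satisfies nu (x - z) < nu (x - y1) or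
    nu (x - z) < nu (x - y2). Quantifiers are removed by the Tarski-Seidenberg
    theorem (semialgebraic_proj), which follows from quantifier elimination for
    real closed fields; the comparison of values of nu is expressed through the
    graph of nu (semialgebraic_graph_le).

    The set S(C) has empty interior because nu is strictly convex. Let x be in
    S(C), and let y <> x be one of its best approximations. If z is a best
    approximation of a point u strictly between x and y, then
      nu (x - y) <= nu (x - z) <= nu (x - u) + nu (u - z)
                 <= nu (x - u) + nu (u - y) = nu (x - y),
    so the triangle inequality is an equality for x - u and u - z; strict
    convexity makes these vectors positively proportional, whence z = y
    (unique_between). So every x in S(C) is a limit of points outside S(C).

    Strict convexity (norm_strictly_convex) comes from the two differentiability
    assumptions. If nu (a + b) = nu a + nu b, the gradient g of nu at a + b is a
    linear form bounded by nu and equal to nu at a + b, hence also at a and at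
    b. The unit vectors on a and b thus both maximize g on the unit sphere, and
    each of them, as a linear form, supports the dual norm at g. The dual norm
    being differentiable at g, both are its gradient there, so they coincide.

    A semi-algebraic set with empty interior is a finite union of basic sets,
    each of which, if nonempty, has among its equations one that does not hold
    identically, as it would otherwise be open. The product of these
    polynomials vanishes on the whole set, and its zero set is closed with empty
    interior (thin_semialgebraic, nowhere_dense_thin, hypersurface_thin). *)

Set Implicit Arguments.
Unset Strict Implicit.

Import Order.TTheory GRing.Theory Num.Theory.
Import numFieldNormedType.Exports.

Local Open Scope classical_set_scope.
Local Open Scope ring_scope.

(** * Boolean operations on semi-algebraic sets *)

Section Boolean.
Context {R : realType} {n : nat}.
Implicit Types (A B : set 'rV[R]_n) (p q : mpoly.mpoly n R).

Lemma semialgebraic_basic d : semialgebraic (@basic_semialgebraic R n d).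
Proof. by exists [:: d]; rewrite big_seq1. Qed.

Lemma semialgebraic_set0 : semialgebraic (set0 : set 'rV[R]_n).
Proof. by exists [::]; rewrite big_nil. Qed.

Lemma semialgebraic_setT : semialgebraic (setT : set 'rV[R]_n).
Proof.
suff -> : setT = basic_semialgebraic ([::], [::]) :> set 'rV[R]_n.
  exact: semialgebraic_basic.
by apply/seteqP; split.
Qed.

Lemma semialgebraic_cst (P : Prop) : semialgebraic [set _ : 'rV[R]_n | P].
Proof.
have [HP|nHP] := pselect P.
  suff -> : [set _ : 'rV[R]_n | P] = setT by exact: semialgebraic_setT.
  by apply/seteqP; split.
suff -> : [set _ : 'rV[R]_n | P] = set0 by exact: semialgebraic_set0.
by apply/seteqP; split.
Qed.

Lemma semialgebraic_zero p : semialgebraic [set x | peval p x = 0].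
Proof.
suff -> : [set x | peval p x = 0] = basic_semialgebraic ([:: p], [::]).
  exact: semialgebraic_basic.
by apply/seteqP; split => x; rewrite /basic_semialgebraic /= !andbT => /eqP.
Qed.

Lemma semialgebraic_pos p : semialgebraic [set x | 0 < peval p x].
Proof.
suff -> : [set x | 0 < peval p x] = basic_semialgebraic ([::], [:: p]).
  exact: semialgebraic_basic.
by apply/seteqP; split => x; rewrite /basic_semialgebraic /= andbT.
Qed.

Lemma semialgebraic_setU A B :
  semialgebraic A -> semialgebraic B -> semialgebraic (A `|` B).
Proof. by move=> [s ->] [t ->]; exists (s ++ t); rewrite big_cat. Qed.

Lemma basic_semialgebraicI d e :
  basic_semialgebraic d `&` basic_semialgebraic e =
  basic_semialgebraic (d.1 ++ e.1, d.2 ++ e.2) :> set 'rV[R]_n.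
Proof.
apply/seteqP; split => x; rewrite /basic_semialgebraic /= !all_cat.
  by move=> [/andP[-> ->] /andP[-> ->]].
by move=> /andP[/andP[-> ->] /andP[-> ->]].
Qed.

Lemma semialgebraic_setI A B :
  semialgebraic A -> semialgebraic B -> semialgebraic (A `&` B).
Proof.
move=> [s ->] [t ->]; elim: s => [|d s IHs].
  by rewrite big_nil set0I; exact: semialgebraic_set0.
rewrite big_cons setIUl; apply: semialgebraic_setU => {IHs}//.
elim: t => [|e t IHt].
  by rewrite big_nil setI0; exact: semialgebraic_set0.
rewrite big_cons setIUr; apply: semialgebraic_setU => //.
by rewrite basic_semialgebraicI; exact: semialgebraic_basic.
Qed.

Lemma semialgebraic_neg p : semialgebraic [set x | peval p x < 0].
Proof.
suff -> : [set x | peval p x < 0] = [set x | 0 < peval (- p) x].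
  exact: semialgebraic_pos.
by apply/seteqP; split => x /=; rewrite /peval mpoly.mevalN oppr_gt0.
Qed.

(** Over an ordered field the negation of an equation or of a strict
    inequality is a disjunction of such conditions. *)
Lemma semialgebraic_basicC d : semialgebraic (~` @basic_semialgebraic R n d).
Proof.
case: d => E F.
have -> : ~` basic_semialgebraic (E, F) =
    [set x | ~~ all (fun p => peval p x == 0) E] `|`
    [set x | ~~ all (fun q => 0 < peval q x) F] :> set 'rV[R]_n.
  apply/seteqP; split => x; rewrite /basic_semialgebraic /=.
    by move/negP; rewrite negb_and => /orP.
  by move/orP; rewrite -negb_and => /negP.
apply: semialgebraic_setU.
  elim: E => [|p E IHE] /=; first exact: semialgebraic_cst.
  suff -> : [set x | ~~ ((peval p x == 0) && all (fun p => peval p x == 0) E)] =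
      ([set x | 0 < peval p x] `|` [set x | peval p x < 0]) `|`
      [set x | ~~ all (fun p => peval p x == 0) E].
    apply: semialgebraic_setU => //; apply: semialgebraic_setU.
      exact: semialgebraic_pos.
    exact: semialgebraic_neg.
  apply/seteqP; split => x /=.
    by case: (ltgtP (peval p x) 0) => /= H; tauto.
  by move=> [[/gt_eqF ->|/lt_eqF ->]|/negPf ->]; rewrite ?andbF.
elim: F => [|q F IHF] /=; first exact: semialgebraic_cst.
suff -> : [set x | ~~ ((0 < peval q x) && all (fun p => 0 < peval p x) F)] =
    ([set x | peval q x = 0] `|` [set x | peval q x < 0]) `|`
    [set x | ~~ all (fun q => 0 < peval q x) F].
  apply: semialgebraic_setU => //; apply: semialgebraic_setU.
    exact: semialgebraic_zero.
  exact: semialgebraic_neg.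
apply/seteqP; split => x /=.
  by case: (ltgtP (peval q x) 0) => /= H; tauto.
by move=> [[->|/lt_gtF ->]|/negPf ->]; rewrite ?ltxx ?andbF.
Qed.

Lemma semialgebraic_setC A : semialgebraic A -> semialgebraic (~` A).
Proof.
move=> [s ->]; elim: s => [|d s IHs].
  by rewrite big_nil setC0; exact: semialgebraic_setT.
rewrite big_cons setCU; apply: semialgebraic_setI => //.
exact: semialgebraic_basicC.
Qed.

Lemma semialgebraic_all (I : Type) (r : seq I) (A : I -> set 'rV[R]_n) :
  (forall i, semialgebraic (A i)) ->
  semialgebraic (\big[setI/setT]_(i <- r) A i).
Proof.
move=> sA; elim: r => [|i r IHr].
  by rewrite big_nil; exact: semialgebraic_setT.
by rewrite big_cons; exact: semialgebraic_setI.
Qed.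

End Boolean.

(** * Polynomial functions and maps *)

Section PolynomialFunctions.
Context {R : realType}.

(** Polynomials are handled through the functions that they define, so that
    substitutions and evaluations are compositions of functions. *)
Definition polyfun n (f : 'rV[R]_n -> R) :=
  exists p : mpoly.mpoly n R, f =1 peval p.

Lemma polyfun_peval n p : polyfun (@peval R n p).
Proof. by exists p. Qed.

Lemma polyfun_cst n c : polyfun (fun _ : 'rV[R]_n => c).
Proof. by exists (mpoly.mpolyC n c) => x; rewrite /peval mpoly.mevalC. Qed.

Lemma polyfun_coord n i : polyfun (fun x : 'rV[R]_n => x ord0 i).
Proof. by exists (mpoly.mpolyX R (mpoly.mnm1 i)) => x; rewrite /peval mpoly.mevalXU. Qed.

Lemma polyfunD n (f g : 'rV[R]_n -> R) :
  polyfun f -> polyfun g -> polyfun (fun x => f x + g x).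
Proof.
by move=> [p fp] [q gq]; exists (p + q) => x; rewrite fp gq /peval mpoly.mevalD.
Qed.

Lemma polyfunN n (f : 'rV[R]_n -> R) : polyfun f -> polyfun (fun x => - f x).
Proof. by move=> [p fp]; exists (- p) => x; rewrite fp /peval mpoly.mevalN. Qed.

Lemma polyfunM n (f g : 'rV[R]_n -> R) :
  polyfun f -> polyfun g -> polyfun (fun x => f x * g x).
Proof.
by move=> [p fp] [q gq]; exists (p * q) => x; rewrite fp gq /peval mpoly.mevalM.
Qed.

Lemma polyfunX n (f : 'rV[R]_n -> R) k : polyfun f -> polyfun (fun x => f x ^+ k).
Proof.
move=> pf; elim: k => [|k IHk]; first exact: polyfun_cst.
by under eq_fun do rewrite exprS; exact: polyfunM.
Qed.

(** Composition, continuity, restriction to a line and translation into terms are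
    all compatible with sums and products of functions; this principle reduces
    them to constants and coordinates. *)
Lemma peval_ind n (P : ('rV[R]_n -> R) -> Prop) :
  (forall c, P (fun=> c)) -> (forall i, P (fun x => x ord0 i)) ->
  (forall f g, P f -> P g -> P (fun x => f x + g x)) ->
  (forall f g, P f -> P g -> P (fun x => f x * g x)) ->
  forall p, P (peval p).
Proof.
move=> PC PX PD PM p.
have Psum (I : Type) (r : seq I) (F : I -> 'rV[R]_n -> R) :
    (forall i, P (F i)) -> P (fun x => \sum_(i <- r) F i x).
  move=> PF; elim: r => [|i r IHr].
    by under eq_fun do rewrite big_nil; exact: PC.
  by under eq_fun do rewrite big_cons; exact: PD.
have Pprod (I : Type) (r : seq I) (F : I -> 'rV[R]_n -> R) :
    (forall i, P (F i)) -> P (fun x => \prod_(i <- r) F i x).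
  move=> PF; elim: r => [|i r IHr].
    by under eq_fun do rewrite big_nil; exact: PC.
  by under eq_fun do rewrite big_cons; exact: PM.
rewrite /peval; under eq_fun do rewrite mpoly.mevalE.
apply: Psum => m; apply: (PM); first exact: PC.
apply: Pprod => i.
suff PXk k : P (fun x => x ord0 i ^+ k) by exact: PXk.
elim: k => [|k IHk]; first exact: PC.
by under eq_fun do rewrite exprS; exact: PM.
Qed.

Definition polymap m n (f : 'rV[R]_m -> 'rV[R]_n) :=
  forall j, polyfun (fun x => f x ord0 j).

Lemma polyfun_comp m n (f : 'rV[R]_m -> 'rV[R]_n) g :
  polymap f -> polyfun g -> polyfun (fun x => g (f x)).
Proof.
move=> pf [p /funext ->].
apply: (@peval_ind _ (fun g => polyfun (fun x => g (f x)))) => //.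
- exact: polyfun_cst.
- by move=> g1 g2; exact: polyfunD.
- by move=> g1 g2; exact: polyfunM.
Qed.

Lemma polymap_comp l m n (f : 'rV[R]_l -> 'rV[R]_m) (g : 'rV[R]_m -> 'rV[R]_n) :
  polymap f -> polymap g -> polymap (fun x => g (f x)).
Proof. by move=> pf pg j; exact: (polyfun_comp pf (pg j)). Qed.

Lemma polymap_id n : polymap (@id 'rV[R]_n).
Proof. exact: polyfun_coord. Qed.

Lemma polymap_cst m n (y : 'rV[R]_n) : polymap (fun _ : 'rV[R]_m => y).
Proof. by move=> j; exact: polyfun_cst. Qed.

Lemma polymapB m n (f g : 'rV[R]_m -> 'rV[R]_n) :
  polymap f -> polymap g -> polymap (fun x => f x - g x).
Proof.
move=> pf pg j; under eq_fun do rewrite !mxE.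
by apply: polyfunD; [exact: pf|exact/polyfunN/pg].
Qed.

Lemma polymap_row_mx m n1 n2 (f : 'rV[R]_m -> 'rV[R]_n1)
    (g : 'rV[R]_m -> 'rV[R]_n2) :
  polymap f -> polymap g -> polymap (fun x => row_mx (f x) (g x)).
Proof.
by move=> pf pg j; under eq_fun do rewrite mxE; case: (fintype.split j) => i;
  [exact: pf|exact: pg].
Qed.

Lemma polymap_lsubmx m n : polymap (lsubmx : 'rV[R]_(m + n) -> 'rV[R]_m).
Proof. by move=> j; under eq_fun do rewrite mxE; exact: polyfun_coord. Qed.

Lemma polymap_rsubmx m n : polymap (rsubmx : 'rV[R]_(m + n) -> 'rV[R]_n).
Proof. by move=> j; under eq_fun do rewrite mxE; exact: polyfun_coord. Qed.

(** Changes of variables are all polynomial maps; with this lemma the blocks of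
    coordinates of a row vector can be rearranged freely. *)
Lemma semialgebraic_preimage m n (f : 'rV[R]_m -> 'rV[R]_n) A :
  polymap f -> semialgebraic A -> semialgebraic [set x | A (f x)].
Proof.
move=> pf [s ->]; elim: s => [|d s IHs].
  by rewrite big_nil; exact: semialgebraic_set0.
rewrite big_cons; apply: semialgebraic_setU IHs.
case: d => E F.
suff : semialgebraic ([set x | all (fun p => peval p (f x) == 0) E] `&`
    [set x | all (fun q => 0 < peval q (f x)) F]).
  by congr semialgebraic; apply/seteqP; split => x /andP.
apply: semialgebraic_setI.
  elim: E => [|p E IHE] /=; first exact: semialgebraic_cst.
  suff -> : [set x | (peval p (f x) == 0) && all (fun p => peval p (f x) == 0) E]
      = [set x | peval p (f x) = 0] `&`
        [set x | all (fun p => peval p (f x) == 0) E].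
    apply: semialgebraic_setI IHE.
    have [q fq] := polyfun_comp pf (polyfun_peval p).
    under eq_set do rewrite fq; exact: semialgebraic_zero.
  apply/seteqP; split => x /=; first by move=> /andP[/eqP].
  by move=> [/eqP -> ->].
elim: F => [|p F IHF] /=; first exact: semialgebraic_cst.
suff -> : [set x | (0 < peval p (f x)) && all (fun p => 0 < peval p (f x)) F]
    = [set x | 0 < peval p (f x)] `&`
      [set x | all (fun p => 0 < peval p (f x)) F].
  apply: semialgebraic_setI IHF.
  have [q fq] := polyfun_comp pf (polyfun_peval p).
  under eq_set do rewrite fq; exact: semialgebraic_pos.
by apply/seteqP; split => x /= /andP.
Qed.

End PolynomialFunctions.

(** * The Tarski-Seidenberg theorem *)

Section TarskiSeidenberg.
Context {R : realType}.
Import ordered_qelim.ord.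

Definition env n (x : 'rV[R]_n) : seq R := [seq x ord0 i | i <- enum 'I_n].

Lemma size_env n (x : 'rV[R]_n) : size (env x) = n.
Proof. by rewrite size_map size_enum_ord. Qed.

Lemma nth_env n (x : 'rV[R]_n) (i : 'I_n) : (env x)`_i = x ord0 i.
Proof. by rewrite (nth_map i) ?size_enum_ord// nth_ord_enum. Qed.

(** Assigning the first variable that is not a coordinate appends a coordinate,
    so quantifying over that variable is projecting. *)
Lemma env_rcons n (x : 'rV[R]_n) r :
  set_nth 0 (env x) n r = env (row_mx x (r%:M : 'rV_1)).
Proof.
apply: (@eq_from_nth _ 0) => [|i].
  by rewrite size_set_nth !size_env addn1; apply/maxn_idPl.
rewrite size_set_nth size_env (maxn_idPl _)// nth_set_nth /= => lt_in.
have lt_in' : (i < n + 1)%N by rewrite addn1.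
rewrite -[i in RHS]/(nat_of_ord (Ordinal lt_in')) nth_env mxE.
case: eqP => [eq_in|ne_in]; case: splitP => j /= ij.
- by have := ltn_ord j; rewrite -ij eq_in ltnn.
- by rewrite mxE !ord1 mulr1n.
- by rewrite ij nth_env.
- by case: ne_in; rewrite ij ord1 addn0.
Qed.

(** A variable beyond the dimension has the default value 0, hence is a constant
    function. *)
Lemma rterm_polyfun n (t : GRing.term R) :
  GRing.rterm t -> polyfun (fun x : 'rV[R]_n => GRing.eval (env x) t).
Proof.
elim: t => //=.
- move=> i _; have [lt_in|le_ni] := ltnP i n.
    rewrite -[i]/(nat_of_ord (Ordinal lt_in)).
    by under eq_fun do rewrite nth_env; exact: polyfun_coord.
  under eq_fun => x do rewrite nth_default ?size_env//.
  exact: polyfun_cst.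
- by move=> c _; exact: polyfun_cst.
- by move=> c _; exact: polyfun_cst.
- by move=> s IHs t IHt /andP[/IHs ps /IHt]; exact: polyfunD.
- by move=> s IHs /IHs; exact: polyfunN.
- move=> s IHs k /IHs ps; under eq_fun do rewrite -mulr_natr.
  by apply: polyfunM => //; exact: polyfun_cst.
- by move=> s IHs t IHt /andP[/IHs ps /IHt]; exact: polyfunM.
- by move=> s IHs k /IHs; exact: polyfunX.
Qed.

Lemma semialgebraic_qf n (f : formula R) :
  qf_form f -> rformula f ->
  semialgebraic [set x : 'rV[R]_n | qf_eval (env x) f].
Proof.
have dif (s t : GRing.term R) : GRing.rterm s && GRing.rterm t ->
    exists p, forall x : 'rV[R]_n,
      peval p x = GRing.eval (env x) t - GRing.eval (env x) s.
  move=> /andP[/(@rterm_polyfun n) ps /(@rterm_polyfun n) pt].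
  by have [p fp] := polyfunD pt (polyfunN ps); exists p.
elim: f => //=.
- by move=> b _ _; exact: semialgebraic_cst.
- move=> s t _ /dif[p pE].
  suff -> : [set x : 'rV[R]_n | GRing.eval (env x) s == GRing.eval (env x) t] =
     [set x | peval p x = 0] by exact: semialgebraic_zero.
  apply/seteqP; split => x /=; rewrite pE; first by move/eqP ->; rewrite subrr.
  by move/eqP; rewrite subr_eq0 eq_sym.
- move=> s t _ /dif[p pE].
  under eq_set do rewrite -subr_gt0 -pE; exact: semialgebraic_pos.
- move=> s t _ /dif[p pE].
  under eq_set do rewrite -subr_ge0 -pE leNgt.
  have -> : [set x : 'rV[R]_n | ~~ (peval p x < 0)] = ~` [set x | peval p x < 0].
    by apply/seteqP; split => x /negP.
  exact/semialgebraic_setC/semialgebraic_neg.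
- move=> f IHf g IHg /andP[qf qg] /andP[rf rg].
  have -> : [set x : 'rV[R]_n | qf_eval (env x) f && qf_eval (env x) g] =
     [set x | qf_eval (env x) f] `&` [set x | qf_eval (env x) g].
    by apply/seteqP; split => x /andP.
  by apply: semialgebraic_setI; [exact: IHf|exact: IHg].
- move=> f IHf g IHg /andP[qf qg] /andP[rf rg].
  have -> : [set x : 'rV[R]_n | qf_eval (env x) f || qf_eval (env x) g] =
     [set x | qf_eval (env x) f] `|` [set x | qf_eval (env x) g].
    by apply/seteqP; split => x /orP.
  by apply: semialgebraic_setU; [exact: IHf|exact: IHg].
- move=> f IHf g IHg /andP[qf qg] /andP[rf rg].
  have -> : [set x : 'rV[R]_n | qf_eval (env x) f ==> qf_eval (env x) g] =
     ~` [set x | qf_eval (env x) f] `|` [set x | qf_eval (env x) g].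
    apply/seteqP; split => x /=; rewrite implybE; first by move=> /orP[/negP|]; tauto.
    by move=> [/negP ->|->] //; rewrite orbT.
  by apply: semialgebraic_setU; [exact/semialgebraic_setC/IHf|exact: IHg].
- move=> f IHf qf rf.
  have -> : [set x : 'rV[R]_n | ~~ qf_eval (env x) f] = ~` [set x | qf_eval (env x) f].
    by apply/seteqP; split => x /negP.
  exact/semialgebraic_setC/IHf.
Qed.

(** This is where quantifiers disappear: over a real closed field each formula is
    equivalent to a quantifier-free formula without inverses. *)
Lemma semialgebraic_formula n (f : formula R) :
  semialgebraic [set x : 'rV[R]_n | holds (env x) f].
Proof.
pose wproj i bc := qe_rcf.qfr_to_formula (@qe_rcf.wproj R i bc).
have wf : forall i bc, dnf_rterm (w_to_oclause bc) ->
    qf_form (wproj i bc) && rformula (wproj i bc) := @qe_rcf.wf_QE_wproj R.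
have /andP[qf rf] := quantifier_elim_wf wf (to_rform_rformula f).
have -> : [set x : 'rV[R]_n | holds (env x) f] =
    [set x | qf_eval (env x) (quantifier_elim wproj (to_rform f))].
  by apply/seteqP; split => x /= /(proj_satP wf (@qe_rcf.valid_QE_wproj R)).
exact: semialgebraic_qf.
Qed.

Lemma peval_term n (p : mpoly.mpoly n R) :
  exists t : GRing.term R, forall x, peval p x = GRing.eval (env x) t.
Proof.
pose P f := exists t : GRing.term R, forall x : 'rV_n, f x = GRing.eval (env x) t.
apply: (@peval_ind R n P _ _ _ _ p).
- by move=> c; exists (GRing.Const c).
- by move=> i; exists (GRing.Var R i) => x /=; rewrite nth_env.
- by move=> f g [s fs] [t gt]; exists (GRing.Add s t) => x /=; rewrite fs gt.
- by move=> f g [s fs] [t gt]; exists (GRing.Mul s t) => x /=; rewrite fs gt.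
Qed.

Lemma formula_semialgebraic n (A : set 'rV[R]_n) :
  semialgebraic A -> exists f : formula R, forall x, A x <-> holds (env x) f.
Proof.
move=> [s ->]; elim: s => [|[E F] s [f fP]].
  by exists (Bool false) => x; rewrite big_nil.
have [e eP] : exists e : formula R, forall x,
    all (fun p => peval p x == 0) E <-> holds (env x) e.
  elim: E => [|p E [e eP]]; first by exists (Bool true).
  have [t tP] := peval_term p.
  exists (And (Equal t (GRing.Const 0)) e) => x /=; rewrite -eP -tP.
  by split => [/andP[/eqP]|[/eqP -> ->]].
have [g gP] : exists g : formula R, forall x,
    all (fun p => 0 < peval p x) F <-> holds (env x) g.
  elim: F => [|p F [g gP]]; first by exists (Bool true).
  have [t tP] := peval_term p.
  exists (And (Lt (GRing.Const 0) t) g) => x /=; rewrite -gP -tP.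
  by split => /andP.
exists (Or (And e g) f) => x; rewrite big_cons /= -fP -eP -gP.
rewrite /basic_semialgebraic /setU /=; split; case=> H; [left| by right|left|by right].
  exact/andP.
exact/andP.
Qed.

Lemma semialgebraic_proj1 n (A : set 'rV[R]_(n + 1)) :
  semialgebraic A ->
  semialgebraic [set x | exists r : R, A (row_mx x (r%:M : 'rV_1))].
Proof.
move=> /formula_semialgebraic[f fP].
suff -> : [set x | exists r : R, A (row_mx x (r%:M : 'rV_1))] =
    [set x | holds (env x) (Exists n f)] by exact: semialgebraic_formula.
by apply/seteqP; split => x /= [r]; [move/fP|move=> H];
  exists r; [rewrite env_rcons|apply/fP; rewrite -env_rcons].
Qed.

(** The last m coordinates are projected out one at a time; in the induction step
    f regroups them so that the first one joins the leading block, where it stays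
    until the others are gone. *)
Lemma semialgebraic_proj n m (A : set 'rV[R]_(n + m)) :
  semialgebraic A -> semialgebraic [set x | exists y, A (row_mx x y)].
Proof.
elim: m n A => [|m IHm] n A sA.
  suff -> : [set x | exists y, A (row_mx x y)] = [set x | A (row_mx x 0)].
    apply: semialgebraic_preimage sA.
    by apply: polymap_row_mx; [exact: polymap_id|exact: polymap_cst].
  apply/seteqP; split => x /=; last by exists 0.
  by move=> [y]; rewrite [y]thinmx0.
pose f (w : 'rV[R]_((n + 1) + m)) : 'rV[R]_(n + (1 + m)) :=
  row_mx (lsubmx (lsubmx w)) (row_mx (rsubmx (lsubmx w)) (rsubmx w)).
have pf : polymap f.
  apply: polymap_row_mx; last apply: polymap_row_mx.
  - by apply: polymap_comp; exact: polymap_lsubmx.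
  - by apply: polymap_comp; [exact: polymap_lsubmx|exact: polymap_rsubmx].
  - exact: polymap_rsubmx.
have := semialgebraic_proj1 (IHm _ _ (semialgebraic_preimage pf sA)).
congr semialgebraic; apply/seteqP; split => x /=.
  move=> [r [y Ay]]; exists (row_mx (r%:M : 'rV_1) y).
  by move: Ay; rewrite /f !(row_mxKl, row_mxKr).
move=> [y Ay]; exists ((lsubmx (y : 'rV_(1 + m))) ord0 ord0), (rsubmx (y : 'rV_(1 + m))).
rewrite /f !(row_mxKl, row_mxKr).
suff -> : (lsubmx (y : 'rV_(1 + m)) ord0 ord0)%:M = lsubmx (y : 'rV_(1 + m)) :> 'rV_1.
  by rewrite hsubmxK.
by apply/rowP => i; rewrite !ord1 !mxE.
Qed.

End TarskiSeidenberg.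

(** * Semi-algebraicity of the set of nonuniqueness *)

Section Nonuniqueness.
Context {R : realType}.

Lemma semialgebraic_polyfun_le n (f g : 'rV[R]_n -> R) :
  polyfun f -> polyfun g -> semialgebraic [set x | f x <= g x].
Proof.
move=> pf pg; have [p fp] := polyfunD pg (polyfunN pf).
have -> : [set x | f x <= g x] = ~` [set x | peval p x < 0].
  by apply/seteqP; split => x /=; rewrite -fp subr_lt0 ltNge; [move=> ->|move/negP/negPn].
exact/semialgebraic_setC/semialgebraic_neg.
Qed.

Lemma semialgebraic_polymap_eq m n (f g : 'rV[R]_m -> 'rV[R]_n) :
  polymap f -> polymap g -> semialgebraic [set x | f x = g x].
Proof.
move=> pf pg.
have -> : [set x | f x = g x] =
    \big[setI/setT]_(j <- enum 'I_n) [set x | f x ord0 j = g x ord0 j].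
  rewrite -bigcap_seq; apply/seteqP; split => x /= fg; first by move=> j _ /=; rewrite fg.
  by apply/rowP => j; apply: fg; rewrite /= mem_enum.
apply: semialgebraic_all => j.
have [p pE] := polyfunD (pf j) (polyfunN (pg j)).
suff -> : [set x | f x ord0 j = g x ord0 j] = [set x | peval p x = 0].
  exact: semialgebraic_zero.
apply/seteqP; split => x /=; rewrite -pE; first by move=> ->; rewrite subrr.
by move/eqP; rewrite subr_eq0 => /eqP.
Qed.

Lemma graphE n (f : 'rV[R]_n -> R) x (s : 'rV_1) :
  graph f (row_mx x s) <-> s ord0 ord0 = f x.
Proof.
split=> [[y _ /eq_row_mx[<- <-]]|sf]; first by rewrite mxE mulr1n.
exists x => //; congr row_mx; apply/rowP => i.
by rewrite ord1 mxE mulr1n sf.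
Qed.

(** The values of f at g x and h x are introduced as extra coordinates s1 and s2,
    characterized by (g x, s1) and (h x, s2) being on the graph of f, and then
    projected out. *)
Lemma semialgebraic_graph_le m n (f : 'rV[R]_n -> R) (g h : 'rV[R]_m -> 'rV[R]_n) :
  semialgebraic (graph f) -> polymap g -> polymap h ->
  semialgebraic [set x | f (g x) <= f (h x)].
Proof.
move=> sf pg ph.
pose s1 (w : 'rV[R]_(m + (1 + 1))) : 'rV[R]_1 := lsubmx (rsubmx w).
pose s2 (w : 'rV[R]_(m + (1 + 1))) : 'rV[R]_1 := rsubmx (rsubmx w).
have ps1 : polymap s1.
  by apply: polymap_comp; [exact: polymap_rsubmx|exact: polymap_lsubmx].
have ps2 : polymap s2 by apply: polymap_comp; exact: polymap_rsubmx.
have pgl : polymap (fun w : 'rV[R]_(m + (1 + 1)) => g (lsubmx w)).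
  by apply: polymap_comp pg; exact: polymap_lsubmx.
have phl : polymap (fun w : 'rV[R]_(m + (1 + 1)) => h (lsubmx w)).
  by apply: polymap_comp ph; exact: polymap_lsubmx.
have := semialgebraic_proj (semialgebraic_setI
  (semialgebraic_setI
    (semialgebraic_preimage (polymap_row_mx pgl ps1) sf)
    (semialgebraic_preimage (polymap_row_mx phl ps2) sf))
  (semialgebraic_polyfun_le (ps1 ord0) (ps2 ord0))).
congr semialgebraic; apply/seteqP; split => x /=.
  move=> [y [[]]]; rewrite /s1 /s2 !(row_mxKl, row_mxKr).
  by move=> /graphE <- /graphE <-.
move=> le_gh; exists (row_mx (const_mx (f (g x))) (const_mx (f (h x)))).
rewrite /s1 /s2 !(row_mxKl, row_mxKr); rewrite !mxE; split => //.
by split; apply/graphE; rewrite mxE.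
Qed.

(** With the infimum replaced by a universally quantified inequality, best
    approximation becomes a first-order condition. *)
Lemma best_approxP n (nu : 'rV[R]_n -> R) (C : set 'rV[R]_n) x y :
  is_norm nu ->
  best_approx nu C x y <-> C y /\ forall z, C z -> nu (x - y) <= nu (x - z).
Proof.
move=> [nu_ge0 _ _ _]; have lb : has_lbound [set nu (x - y) | y in C].
  by exists 0 => _ [z _ <-].
split=> [[Cy ->]|[Cy min_y]]; split => //.
  by move=> z Cz; apply: ge_inf => //; exists z.
apply/eqP; rewrite eq_le; apply/andP; split; last by apply: ge_inf => //; exists y.
by apply: lb_le_inf; [exists (nu (x - y)), y|move=> _ [z Cz <-]; exact: min_y].
Qed.

Lemma semialgebraic_best_approx n (nu : 'rV[R]_n -> R) (C : set 'rV[R]_n) :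
  is_norm nu -> semialgebraic C -> semialgebraic (graph nu) ->
  semialgebraic [set w : 'rV[R]_(n + n) | best_approx nu C (lsubmx w) (rsubmx w)].
Proof.
move=> nuN sC snu.
pose x (v : 'rV[R]_((n + n) + n)) : 'rV[R]_n := lsubmx (lsubmx v).
pose y (v : 'rV[R]_((n + n) + n)) : 'rV[R]_n := rsubmx (lsubmx v).
pose z (v : 'rV[R]_((n + n) + n)) : 'rV[R]_n := rsubmx v.
have px : polymap x by apply: polymap_comp; exact: polymap_lsubmx.
have py : polymap y.
  by apply: polymap_comp; [exact: polymap_lsubmx|exact: polymap_rsubmx].
have pz : polymap z by exact: polymap_rsubmx.
have := semialgebraic_setI
  (semialgebraic_preimage (@polymap_rsubmx R n n) sC)
  (semialgebraic_setC (semialgebraic_proj (semialgebraic_setI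
    (semialgebraic_preimage pz sC)
    (semialgebraic_setC
      (semialgebraic_graph_le snu (polymapB px py) (polymapB px pz)))))).
congr semialgebraic; apply/seteqP; split => w /=; rewrite /x /y /z.
  move=> [Cy noz]; apply/(best_approxP _ _ _ nuN); split => // z' Cz.
  rewrite leNgt; apply/negP => lt_z; apply: noz; exists z'.
  by rewrite !(row_mxKl, row_mxKr); split => //; apply/negP; rewrite -ltNge.
move/(best_approxP _ _ _ nuN) => [Cy min_y]; split => // -[z' []].
by rewrite !(row_mxKl, row_mxKr) => /min_y.
Qed.

Lemma semialgebraic_nonunique n (nu : 'rV[R]_n -> R) (C : set 'rV[R]_n) :
  is_norm nu -> semialgebraic C -> semialgebraic (graph nu) ->
  semialgebraic (nonunique_set nu C).
Proof.
move=> nuN sC snu.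
pose x (v : 'rV[R]_(n + (n + n))) : 'rV[R]_n := lsubmx v.
pose y1 (v : 'rV[R]_(n + (n + n))) : 'rV[R]_n := lsubmx (rsubmx v).
pose y2 (v : 'rV[R]_(n + (n + n))) : 'rV[R]_n := rsubmx (rsubmx v).
have px : polymap x by exact: polymap_lsubmx.
have py1 : polymap y1.
  by apply: polymap_comp; [exact: polymap_rsubmx|exact: polymap_lsubmx].
have py2 : polymap y2 by apply: polymap_comp; exact: polymap_rsubmx.
have sB := semialgebraic_best_approx nuN sC snu.
have := semialgebraic_proj (semialgebraic_setI
  (semialgebraic_setI
    (semialgebraic_preimage (polymap_row_mx px py1) sB)
    (semialgebraic_preimage (polymap_row_mx px py2) sB))
  (semialgebraic_setC (semialgebraic_polymap_eq py1 py2))).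
congr semialgebraic; apply/seteqP; split => v /=; rewrite /x /y1 /y2.
  move=> [w]; rewrite !(row_mxKl, row_mxKr) => -[[b1 b2] ne].
  by exists (lsubmx w), (rsubmx w).
move=> [w1 [w2 [b1 b2 ne]]]; exists (row_mx w1 w2).
by rewrite !(row_mxKl, row_mxKr).
Qed.

End Nonuniqueness.

(** * Semi-algebraic sets with empty interior *)

Section ThinSets.
Context {R : realType}.

Lemma continuous_peval n (p : mpoly.mpoly n R) : continuous (peval p : 'rV[R]_n -> R).
Proof.
apply: (@peval_ind R n (fun f => continuous (f : 'rV[R]_n -> R))).
- by move=> c; exact: cst_continuous.
- by move=> i; exact: coord_continuous.
- by move=> f g cf cg x; apply: continuousD; [exact: cf|exact: cg].
- by move=> f g cf cg x; apply: continuousM; [exact: cf|exact: cg].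
Qed.

Lemma peval_line n (p : mpoly.mpoly n R) (x v : 'rV[R]_n) :
  exists q : {poly R}, forall t, peval p (x + t *: v) = q.[t].
Proof.
apply: (@peval_ind R n (fun f => exists q : {poly R}, forall t, f (x + t *: v) = q.[t])).
- by move=> c; exists c%:P => t; rewrite hornerC.
- move=> i; exists ((x ord0 i)%:P + 'X * (v ord0 i)%:P) => t.
  by rewrite !hornerE !mxE.
- by move=> f g [q fq] [r gr]; exists (q + r) => t; rewrite hornerD fq gr.
- by move=> f g [q fq] [r gr]; exists (q * r) => t; rewrite hornerM fq gr.
Qed.

(** The points e / (k + 2) give more roots near 0 than the degree allows. *)
Lemma poly_nonroot_near0 (q : {poly R}) (A : set R) :
  q != 0 -> nbhs 0 A -> exists2 t, A t & q.[t] != 0.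
Proof.
move=> q0 /nbhs_ballP[e /= e0 eA].
apply: contrapT => noroot.
pose rs := [seq e / k.+2%:R | k <- iota 0 (size q)].
suff : (size rs < size q)%N by rewrite size_map size_iota ltnn.
apply: max_poly_roots => //.
  apply/allP => _ /mapP[k _ ->]; apply: contrapT => nr.
  apply: noroot; exists (e / k.+2%:R); last exact/negP.
  apply: eA; rewrite /ball /= sub0r normrN ger0_norm ?divr_ge0 ?ltW//.
  by rewrite ltr_pdivrMr// ltr_pMr// ltr1n.
rewrite map_inj_uniq ?iota_uniq// => i j /(mulfI (lt0r_neq0 e0))/invr_inj/eqP.
by rewrite eqr_nat => /eqP[].
Qed.

(** A condition on the function rather than on p: basic sets see only the
    values of p, and a witness point is what the restriction to a line uses. *)
Definition not_identically0 n (p : mpoly.mpoly n R) :=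
  exists a : 'rV[R]_n, peval p a != 0.

(** On the line from a point x of U to a point a where p does not vanish, p is a
    nonzero polynomial in one variable, so it has nonroots close to x. *)
Lemma open_nonzero n (p : mpoly.mpoly n R) (U : set 'rV[R]_n) :
  not_identically0 p -> open U -> U !=set0 -> exists2 x, U x & peval p x != 0.
Proof.
move=> [a pa] oU [x Ux].
have [q qE] := peval_line p x (a - x).
have q0 : q != 0.
  apply: contraNneq pa => q0.
  by have := qE 1; rewrite q0 horner0 scale1r subrKC => ->.
have [|t Ut qt] := @poly_nonroot_near0 q [set t | U (x + t *: (a - x))] q0.
  have ct : {for 0, continuous (fun t : R => x + t *: (a - x))}.
    by apply: cvgD; [exact: cvg_cst|apply: cvgZr_tmp; exact: cvg_id].
  apply: ct; rewrite scale0r addr0; exact: open_nbhs_nbhs.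
by exists (x + t *: (a - x)) => //; rewrite qE.
Qed.

Lemma open_peval_neq0 n (p : mpoly.mpoly n R) :
  open [set x : 'rV[R]_n | peval p x != 0].
Proof.
apply: (@open_comp _ _ (peval p) [set y | y != 0]).
  by move=> x _; exact: continuous_peval.
exact: open_neq.
Qed.

Lemma not_identically0M n (p q : mpoly.mpoly n R) :
  not_identically0 p -> not_identically0 q -> not_identically0 (p * q).
Proof.
move=> np nq.
have [x qx px] := open_nonzero np (@open_peval_neq0 _ q) nq.
by exists x; rewrite /peval mpoly.mevalM mulf_neq0.
Qed.

Lemma open_pos n (F : seq (mpoly.mpoly n R)) :
  open [set x : 'rV[R]_n | all (fun q => 0 < peval q x) F].
Proof.
elim: F => [|q F IHF] /=.
  rewrite (_ : [set x | _] = setT); first exact: openT.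
  by apply/seteqP; split.
rewrite (_ : [set x | _] = [set x | 0 < peval q x] `&`
   [set x | all (fun q => 0 < peval q x) F]); last first.
  by apply/seteqP; split => x /andP.
apply: openI => //.
apply: (@open_comp _ _ (peval q) [set y | 0 < y]).
  by move=> x _; exact: continuous_peval.
exact: open_gt.
Qed.

(** If all the equations held identically, the basic set would be cut out by
    strict inequalities alone, hence open, and then empty. *)
Lemma thin_basic n d :
  interior (@basic_semialgebraic R n d) = set0 ->
  exists2 p, not_identically0 p & basic_semialgebraic d `<=` [set x | peval p x = 0].
Proof.
case: d => E F thin.
have [[p pE np]|allz] := pselect (exists2 p, p \in E & not_identically0 p).
  exists p => // x /andP[/allP/(_ _ pE)/eqP //].
exists (mpoly.mpolyC n 1).
  by exists 0; rewrite /peval mpoly.mevalC oner_neq0.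
move=> x dx; exfalso.
suff : interior (basic_semialgebraic (E, F)) x by rewrite thin.
rewrite (_ : basic_semialgebraic (E, F) =
    [set x | all (fun q => 0 < peval q x) F]).
  rewrite (interior_id _).1; last exact: open_pos.
  by case/andP: dx.
apply/seteqP; split => y; first by case/andP.
move=> /= Fy; apply/andP; split => //=.
apply/allP => p pE; apply/negP => /negP py.
by apply: allz; exists p => //; exists y.
Qed.

Lemma thin_semialgebraic n (A : set 'rV[R]_n) :
  semialgebraic A -> interior A = set0 ->
  exists2 p, not_identically0 p & A `<=` [set x | peval p x = 0].
Proof.
move=> [s ->]; elim: s => [|d s IHs].
  exists (mpoly.mpolyC n 1); last by rewrite big_nil.
  by exists 0; rewrite /peval mpoly.mevalC oner_neq0.
rewrite big_cons => thin.
have [|p np dp] := @thin_basic n d.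
  by apply/seteqP; split => // x dx; rewrite -thin; apply: interiorS dx; exact: subsetUl.
have [|q nq sq] := IHs.
  by apply/seteqP; split => // x dx; rewrite -thin; apply: interiorS dx; exact: subsetUr.
exists (p * q); first exact: not_identically0M.
move=> x [/dp|/sq] /=; rewrite /peval mpoly.mevalM => ->; first by rewrite mul0r.
by rewrite mulr0.
Qed.

Lemma nowhere_dense_thin n (A : set 'rV[R]_n) p :
  not_identically0 p -> A `<=` [set x | peval p x = 0] -> nowhere_dense A.
Proof.
move=> np Ap; apply/seteqP; split => // x clAx.
have [|y /interior_subset cly py] :=
  open_nonzero np (@open_interior _ (closure A)); first by exists x.
have cZ : closed [set x : 'rV[R]_n | peval p x = 0].
  apply: (@closed_comp _ _ (peval p) [set y | y = 0]).
    by move=> z _; exact: continuous_peval.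
  exact: closed_eq.
have := closure_subset Ap cly.
by rewrite -(closure_id _).1//= => py0; rewrite py0 eqxx in py.
Qed.

(** The polynomial p may be a nonzero constant, with empty zero set; multiplying it
    by the first variable makes it nonconstant. *)
Lemma hypersurface_thin n p : (0 < n)%N -> not_identically0 p ->
  exists H : set 'rV[R]_n, hypersurface H /\ [set x | peval p x = 0] `<=` H.
Proof.
case: n p => // n p _ np.
pose q : mpoly.mpoly n.+1 R := mpoly.mpolyX R (mpoly.mnm1 ord0).
have qE x : peval q x = x ord0 ord0 by rewrite /peval mpoly.mevalXU.
have nq : not_identically0 q.
  by exists (const_mx 1); rewrite qE mxE oner_neq0.
exists [set x | peval (p * q) x = 0]; split; last first.
  by move=> x /= px; rewrite /peval mpoly.mevalM -/(peval p x) px mul0r.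
exists (p * q); split => // c pqc.
have [a] := not_identically0M np nq.
have : peval (p * q) 0 = 0 by rewrite /peval mpoly.mevalM -/(peval q 0) qE mxE mulr0.
by rewrite pqc /peval !mpoly.mevalC => ->; rewrite eqxx.
Qed.

End ThinSets.

(** * Gradients and strict convexity *)

Section StrictConvexity.
Context {R : realType}.

(** One-sided bounds are enough to determine a differential: applied to v and to
    - v, this lemma gives both inequalities. *)
Lemma differential_ge n (f : 'rV[R]_n -> R) (x v : 'rV[R]_n) (c : R) :
  differentiable f x -> (forall h : R, 0 < h -> f x + h * c <= f (x + h *: v)) ->
  c <= 'd f x v.
Proof.
move=> df fc; rewrite -deriveE//.
have /cvg_dnbhs_at_right cf := @diff_derivable _ _ _ _ _ v df.
apply: (cvgr_to_ge cf).
near=> h.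
have h0 : 0 < h by near: h; exact: nbhs_right_gt.
rewrite /= -[_ *: _]/(_ * _) mulrC ler_pdivlMr// [h *: v + x]addrC.
by rewrite lerBrDl mulrC fc.
Unshelve. all: by end_near.
Qed.

Lemma dotr_linear_form n (g : {linear 'rV[R]_n -> R}) :
  exists c, forall y, g y = dotr y c.
Proof.
exists (\row_i g (delta_mx 0 i)) => y.
rewrite {1}[y]row_sum_delta linear_sum; apply: eq_bigr => i _.
by rewrite linearZ mxE.
Qed.

Lemma dotrDr n (y u v : 'rV[R]_n) : dotr y (u + v) = dotr y u + dotr y v.
Proof. by rewrite -big_split; apply: eq_bigr => i _; rewrite mxE mulrDr. Qed.

Lemma dotrZr n a (y u : 'rV[R]_n) : dotr y (a *: u) = a * dotr y u.
Proof. by rewrite mulr_sumr; apply: eq_bigr => i _; rewrite mxE mulrCA. Qed.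

Lemma dotrZl n a (y u : 'rV[R]_n) : dotr (a *: y) u = a * dotr y u.
Proof. by rewrite mulr_sumr; apply: eq_bigr => i _; rewrite mxE mulrA. Qed.

Lemma dotrDl n (y z u : 'rV[R]_n) : dotr (y + z) u = dotr y u + dotr z u.
Proof. by rewrite -big_split; apply: eq_bigr => i _; rewrite mxE mulrDl. Qed.

Lemma dotr_inj n (y z : 'rV[R]_n) : (forall v, dotr y v = dotr z v) -> y = z.
Proof.
have dotr_delta w i : dotr w (delta_mx 0 i) = w ord0 i.
  rewrite /dotr (bigD1 i)//= mxE !eqxx mulr1 big1 ?addr0// => j ji.
  by rewrite mxE (negPf ji) andbF mulr0.
by move=> yz; apply/rowP => i; rewrite -!dotr_delta yz.
Qed.

Lemma coord_le_norm n (y : 'rV[R]_n) i : `|y ord0 i| <= `|y|.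
Proof.
rewrite [leRHS]mx_normrE.
exact: (le_bigmax _ (fun ij : 'I_1 * 'I_n => `|y ij.1 ij.2|) (ord0, i)).
Qed.

Section Norm.
Context {n : nat} {nu : 'rV[R]_n -> R}.
Hypotheses (nuN : is_norm nu) (dnu : differentiable_norm nu).

Lemma is_norm0 : nu 0 = 0.
Proof. by case: nuN => _ _ nuZ _; rewrite -(scale0r 0) nuZ normr0 mul0r. Qed.

Lemma is_norm_gt0 x : x != 0 -> 0 < nu x.
Proof.
case: nuN => nu_ge0 nu_eq0 _ _ x0; rewrite lt_neqAle nu_ge0 andbT eq_sym.
by apply: contra_neq x0 => /nu_eq0.
Qed.

(** By compactness nu has a positive minimum c on the sphere of the maximum norm,
    so by homogeneity c * `|y| <= nu y for every y. *)
Lemma unit_sphere_bounded : exists K, forall y, nu y = 1 -> `|y| <= K.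
Proof.
have [nu_ge0 nu_eq0 nuZ nuD] := nuN.
pose S := [set y : 'rV[R]_n | `|y| = 1].
have Sn0 y : S y -> y != 0.
  by rewrite /S /= => y1; rewrite -normr_gt0 y1 ltr01.
have norm1 y : y != 0 -> S (`|y|^-1 *: y).
  by move=> y0; rewrite /S /= normrZ normfV normr_id mulVf// normr_eq0.
have [S0|nS] := pselect (S !=set0); last first.
  exists 0 => y nuy; exfalso; apply: nS; exists (`|y|^-1 *: y); apply: norm1.
  by apply: contra_eqN nuy => /eqP ->; rewrite is_norm0 eq_sym oner_neq0.
have cS : compact S.
  apply: bounded_closed_compact.
    exists 1; split; first exact: num_real.
    by move=> M M1 y; rewrite /S /= => ->; exact: ltW.
  apply: (@closed_comp _ _ (@Num.norm R 'rV[R]_n) [set y | y = 1]).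
    by move=> z _; exact: norm_continuous.
  exact: closed_eq.
have cnu : {within S, continuous nu}.
  apply: continuous_in_subspaceT => y; rewrite inE => /Sn0 y0.
  by apply: differentiable_continuous; exact: dnu.
have [c] := EVT_min_rV S0 cS cnu.
rewrite inE => /Sn0/is_norm_gt0 c0 minc.
exists (nu c)^-1 => y nuy.
have y0 : y != 0.
  by apply: contra_eqN nuy => /eqP ->; rewrite is_norm0 eq_sym oner_neq0.
have := minc (`|y|^-1 *: y); rewrite inE => /(_ (norm1 _ y0)).
rewrite nuZ nuy mulr1 normfV normr_id => cy.
by rewrite -[`|y|]invrK lef_pV2 ?posrE ?invr_gt0 ?normr_gt0.
Qed.

(** The supremum is a true upper bound because the unit sphere of nu is
    bounded. *)
Lemma dual_norm_ub y h : nu y = 1 -> dotr y h <= dual_norm nu h.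
Proof.
move=> nuy; apply: ub_le_sup; last by exists y.
have [K KP] := unit_sphere_bounded.
exists (\sum_(i < n) K * `|h ord0 i|) => _ [z nuz <-].
apply: ler_sum => i _; rewrite (le_trans (ler_norm _))// normrM.
by rewrite ler_wpM2r// (le_trans (coord_le_norm _ _))// KP.
Qed.

(** The supporting form is the gradient of nu at w; both properties follow by
    comparing nu (w + h *: v) with nu w, for v = w and for v = - y. *)
Lemma supporting_functional w : w != 0 ->
  exists g, dotr w g = nu w /\ forall y, dotr y g <= nu y.
Proof.
move=> w0; have [nu_ge0 nu_eq0 nuZ nuD] := nuN.
have [g gE] := dotr_linear_form ('d nu w : {linear 'rV[R]_n -> R}).
have le_g y : dotr y g <= nu y.
  rewrite -lerN2 -[- dotr y g]mulN1r -dotrZl scaleN1r -gE.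
  apply: differential_ge => [|h h0]; first exact: dnu.
  rewrite mulrN lerBlDr.
  have := nuD (w + h *: - y) (h *: y).
  by rewrite scalerN addrNK nuZ gtr0_norm.
exists g; split => //; apply/eqP; rewrite eq_le le_g -gE.
apply: differential_ge => [|h h0]; first exact: dnu.
by rewrite -{3}[w]scale1r -scalerDl nuZ gtr0_norm ?addr_gt0// mulrDl mul1r.
Qed.

Hypothesis ddnu : differentiable_norm (dual_norm nu).

(** The linear form of a is below the dual norm and agrees with it at g, so it is
    the differential of the dual norm at g; so is the linear form of b. *)
Lemma support_point_unique g a b : (forall y, dotr y g <= nu y) ->
  nu a = 1 -> nu b = 1 -> dotr a g = 1 -> dotr b g = 1 -> a = b.
Proof.
move=> le_g a1 b1 ga gb.
have g0 : g != 0.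
  apply: contra_eqN ga => /eqP ->; rewrite -(scale0r 0) dotrZr mul0r.
  by rewrite eq_sym oner_neq0.
have dual_g : dual_norm nu g <= 1.
  by apply: ge_sup; [exists (dotr a g), a|move=> _ [y <- <-]].
have ge_d c v : nu c = 1 -> dotr c g = 1 -> dotr c v <= 'd (dual_norm nu) g v.
  move=> c1 gc; apply: differential_ge => [|h h0]; first exact: ddnu.
  rewrite (le_trans _ (dual_norm_ub (g + h *: v) c1))//.
  by rewrite dotrDr dotrZr gc lerD2r.
have eq_d c v : nu c = 1 -> dotr c g = 1 -> dotr c v = 'd (dual_norm nu) g v.
  move=> c1 gc; apply/eqP; rewrite eq_le ge_d//=.
  have := ge_d c (- v) c1 gc.
  by rewrite linearN -scaleN1r dotrZr mulN1r lerN2.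
by apply: dotr_inj => v; rewrite (eq_d a v a1 ga) (eq_d b v b1 gb).
Qed.

(** A form bounded by nu and equal to nu at a + b, where nu is additive, equals nu
    at a and at b. *)
Lemma norm_strictly_convex a b : a != 0 -> b != 0 ->
  nu (a + b) = nu a + nu b -> (nu a)^-1 *: a = (nu b)^-1 *: b.
Proof.
move=> a0 b0 nuab; have [nu_ge0 nu_eq0 nuZ nuD] := nuN.
have na := is_norm_gt0 a0; have nb := is_norm_gt0 b0.
have ab0 : a + b != 0.
  apply: contra_eqN nuab => /eqP ->.
  by rewrite is_norm0 eq_sym gt_eqF// addr_gt0.
have [g [gab le_g]] := supporting_functional ab0.
have ga : dotr a g = nu a.
  apply/eqP; rewrite eq_le le_g/=.
  by rewrite -(lerD2r (nu b)) -nuab -gab dotrDl lerD2l.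
have gb : dotr b g = nu b by apply: (addrI (dotr a g)); rewrite -dotrDl gab nuab ga.
have nuV c : 0 < nu c -> nu ((nu c)^-1 *: c) = 1.
  by move=> c0; rewrite nuZ gtr0_norm ?invr_gt0// mulVf// gt_eqF.
apply: (support_point_unique le_g); rewrite ?nuV// dotrZl.
  by rewrite ga mulVf// gt_eqF.
by rewrite gb mulVf// gt_eqF.
Qed.

(** With u the intermediate point, minimality of y for x and of z for u forces
    equality in the triangle inequality for x - z = (x - u) + (u - z). *)
Lemma unique_between C x y t z : 0 < t -> t < 1 -> x != y ->
  best_approx nu C x y -> best_approx nu C (x + t *: (y - x)) z -> z = y.
Proof.
move=> t0 t1 xy /(best_approxP _ _ _ nuN)[Cy min_y] /(best_approxP _ _ _ nuN)[Cz min_z].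
have [nu_ge0 nu_eq0 nuZ nuD] := nuN.
set u := x + _ in min_z.
have s0 : 0 < 1 - t by rewrite subr_gt0.
have xyn0 : x - y != 0 by rewrite subr_eq0.
have d0 := is_norm_gt0 xyn0.
have xuE : x - u = t *: (x - y) by rewrite /u opprD addNKr -scalerN opprB.
have uyE : u - y = (1 - t) *: (x - y).
  by rewrite scalerBl scale1r -xuE opprB [RHS]addrC addrA subrK.
have nxu : nu (x - u) = t * nu (x - y) by rewrite xuE nuZ gtr0_norm.
have nuy : nu (u - y) = (1 - t) * nu (x - y) by rewrite uyE nuZ gtr0_norm.
have xz : x - z = (x - u) + (u - z) by rewrite addrA subrK.
have le1 : nu (u - z) <= (1 - t) * nu (x - y) by rewrite -nuy min_z.
have le2 := min_y _ Cz.
have le3 : nu (x - z) <= nu (x - u) + nu (u - z) by rewrite xz nuD.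
have nuz : nu (u - z) = (1 - t) * nu (x - y).
  apply/eqP; rewrite eq_le le1 /=.
  have := le_trans le2 le3; rewrite nxu -lerBlDl => /(le_trans _); apply.
  by rewrite mulrBl mul1r.
have nxz : nu ((x - u) + (u - z)) = nu (x - u) + nu (u - z).
  apply/eqP; rewrite eq_le nuD /= -xz (le_trans _ le2)// nxu nuz.
  by rewrite -mulrDl addrC subrK mul1r.
have xu0 : x - u != 0 by rewrite xuE scaler_eq0 negb_or xyn0 gt_eqF.
have uz0 : u - z != 0.
  apply: contra_eqN nuz => /eqP ->; rewrite is_norm0 eq_sym.
  by rewrite mulf_neq0 ?gt_eqF.
have := norm_strictly_convex xu0 uz0 nxz.
rewrite nxu nuz xuE scalerA invfM mulrAC mulVf ?gt_eqF// mul1r.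
move=> /(congr1 (fun w => ((1 - t) * nu (x - y)) *: w)).
rewrite scalerKV ?mulf_neq0 ?gt_eqF// scalerA mulfK ?gt_eqF// -uyE.
by move=> /addrI/oppr_inj.
Qed.

Lemma nonunique_thin C : interior (nonunique_set nu C) = set0.
Proof.
apply/seteqP; split => // x xS.
have [y1 [y2 [b1 b2 ne]]] := interior_subset xS.
(* of two distinct best approximations, at least one is not x *)
have [y [by_ xy]] : exists y, best_approx nu C x y /\ x != y.
  have [xy|xy] := eqVneq x y1; last by exists y1.
  exists y2; split => //; apply/eqP => xy2; apply: ne; by rewrite -xy xy2.
(* these points tend to x, an interior point, as t decreases to 0 *)
have ct : (fun t : R => x + t *: (y - x)) t @[t --> 0^'+] --> x.
  rewrite -[X in _ --> X]addr0 -(scale0r (y - x)).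
  apply: cvgD; first exact: cvg_cst.
  by apply: cvgZr_tmp; apply: cvg_at_right_filter; exact: cvg_id.
have St : \forall t \near (0 : R)^'+, nonunique_set nu C (x + t *: (y - x)).
  exact: ct _ xS.
have [t [t0 t1 [z1 [z2 [c1 c2 nz]]]]] : exists t,
    [/\ 0 < t, t < 1 & nonunique_set nu C (x + t *: (y - x))].
  near (0 : R)^'+ => t; exists t; split; near: t => //.
    exact: nbhs_right_gt.
  exact: nbhs_right_lt.
by apply: nz; rewrite (unique_between t0 t1 xy by_ c1) (unique_between t0 t1 xy by_ c2).
Unshelve. all: by end_near.
Qed.

End Norm.
End StrictConvexity.

(** * Nonunique best approximation *)

Theorem theorem3p7 (R : realType) (n : nat) (hn : (0 < n)%N)
    (C : set 'rV[R]_n) (nu : 'rV[R]_n -> R) :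
  C !=set0 -> closed C -> semialgebraic C ->
  is_norm nu -> semialgebraic (graph nu) ->
  differentiable_norm nu -> differentiable_norm (dual_norm nu) ->
  [/\ nowhere_dense (nonunique_set nu C),
      semialgebraic (nonunique_set nu C)
    & exists H : set 'rV[R]_n, hypersurface H /\ nonunique_set nu C `<=` H].
Proof.
move=> _ _ sC nuN snu dnu ddnu.
have sS := semialgebraic_nonunique nuN sC snu.
have [p np Sp] := thin_semialgebraic sS (nonunique_thin nuN dnu ddnu C).
split=> //; first exact: nowhere_dense_thin np Sp.
have [H [hH pH]] := hypersurface_thin hn np.
by exists H; split => //; exact: subset_trans Sp pH.
Qed.
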